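(* Let $(K,v)$ be a local field of characteristic $0$ and residue field characteristic $p$. Let $f\in\mathcal{O}_K[z]$ be a monic postcritically bounded polynomial of degree $d$ with $f(0)=0$ and $p\mid d$. Suppose that $a\in\mathcal{O}_K$ avoids the postcritical set of $f$ and that $f^n(z)-a$ has $d^n$ distinct roots for all integers $n\geqslant0$. Let $K_n=K(f^{-n}(a))$ and $K_\infty=\bigcup_{n\geqslant0}K_n$. Then $K_\infty/K$ is infinitely wildly ramified, i.e. $v_p(e(K_n/K))\to\infty$ as $n\to\infty$.
   Context: $\mathcal{O}_K$ is the ring of integers of $K$; $\mathbb{C}_v$ is the completion of an algebraic closure of $K$ with absolute value $|\cdot|_v$ extending $v$; $D(a,R)=\{z\in\mathbb{C}_v:|z-a|_v<R\}$. $f^n$ is the $n$th iterate and $f^{-n}(a)$ the set of roots of $f^n(z)=a$ in $\overline{K}$. $f$ is postcritically bounded if the postcritical set $\{f^n(\gamma):n\geqslant0,\ \gamma \text{ a critical point of } f\}\subseteq\mathbb{C}_v$ is bounded. $a$ avoids a set $X$ if $D(a,R)\cap X=\emptyset$ for some $R>0$. $e(K_n/K)$ is the ramification index. *)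

(* Defs.v *)
From HB Require Import structures.
From mathcomp Require Import all_boot all_order all_algebra finmap.
From mathcomp Require Import all_classical all_reals all_analysis.

Set Implicit Arguments.
Unset Strict Implicit.
Unset Printing Implicit Defensive.

Import Order.TTheory GRing.Theory Num.Theory.
Import numFieldNormedType.Exports.

Local Open Scope classical_set_scope.
Local Open Scope ring_scope.

(* The norms of MathComp satisfy |x *+ n| = |x| *+ n, which no nonarchimedean
   absolute value on a field does; hence a separate structure. *)
Record absval (R : realType) (F : fieldType) := AbsVal {
  absval_fun :> F -> R;
  absval_ge0 : forall x, 0 <= absval_fun x;
  absval_eq0 : forall x, absval_fun x = 0 <-> x = 0;
  absvalM : forall x y, absval_fun (x * y) = absval_fun x * absval_fun y;
  absval_ultra : forall x y,
    absval_fun (x + y) <= Num.max (absval_fun x) (absval_fun y) }.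

Section AbsoluteValue.
Variables (R : realType) (F : fieldType) (v : absval R F).

Definition val_ring : {pred F} := [pred x | v x <= 1].

Definition open_disk (a : F) (r : R) : set F := [set z | v (z - a) < r].

Definition absval_bounded (A : set F) : Prop :=
  exists M : R, forall x, A x -> v x <= M.

Definition avoids (a : F) (X : set F) : Prop :=
  exists2 r : R, 0 < r & open_disk a r `&` X = set0.

Definition absval_complete : Prop :=
  forall u : nat -> F,
    (forall e : R, 0 < e -> exists N : nat,
       forall m n, (N <= m)%N -> (N <= n)%N -> v (u m - u n) < e) ->
    exists l : F, v (u n - l) @[n --> \oo] --> (0 : R).

(* Discrete and nontrivial: [pi] is a uniformizer. *)
Definition absval_discrete : Prop :=
  exists pi : F, 0 < v pi < 1 /\
    forall x, x != 0 -> exists k : int, v x = v pi ^ k.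

(* The elements x + m of the residue field O/m, where O is [val_ring] and m is
   the open unit disk. *)
Definition residue_classes : set (set F) :=
  [set open_disk x 1 | x in [set x | x \in val_ring]].

(* [v p%:R < 1] says that p%:R is zero in the residue field. *)
Record local_field (p : nat) : Prop := LocalField {
  local_discrete : absval_discrete;
  local_complete : absval_complete;
  local_residue_finite : finite_set residue_classes;
  local_residue_char : prime p /\ v p%:R < 1 }.

Definition value_group (E : set F) : set R :=
  [set v x | x in E `&` [set x | x != 0]].

End AbsoluteValue.

Definition is_algebraic_closure (K : fieldType) (L : closedFieldType)
  (i : {rmorphism K -> L}) : Prop := integralRange i.

Definition absval_extends (R : realType) (K L : fieldType)
  (v : absval R K) (w : absval R L) (i : {rmorphism K -> L}) : Prop :=
  forall x, w (i x) = v x.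

Record is_completion (R : realType) (L C : fieldType)
  (w : absval R L) (u : absval R C) (j : {rmorphism L -> C}) : Prop :=
  IsCompletion {
    completion_extends : absval_extends w u j;
    completion_complete : absval_complete u;
    completion_dense : forall (x : C) (e : R), 0 < e ->
      exists y : L, u (x - j y) < e }.

Definition iter_poly (K : fieldType) (f : {poly K}) (n : nat) : {poly K} :=
  iter n (fun g => f \Po g) 'X.

Definition iter_preimage (K L : fieldType) (i : {rmorphism K -> L})
  (f : {poly K}) (n : nat) (a : K) : set L :=
  [set x | root (map_poly i (iter_poly f n - a%:P)) x].

Definition critical_point (C : fieldType) (f : {poly C}) (x : C) : Prop :=
  root f^`() x.

Definition postcritical_set (C : fieldType) (f : {poly C}) : set C :=
  [set x | exists n c, critical_point f c /\ x = (iter_poly f n).[c]].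

(* The subfield K(S) of L. *)
Definition adjoin (K L : fieldType) (i : {rmorphism K -> L}) (S : set L) :
  set L :=
  smallest (fun E : set L => divring_closed (mem E)) (range i `|` S).

Definition arboreal_field (K L : fieldType) (i : {rmorphism K -> L})
  (f : {poly K}) (a : K) (n : nat) : set L :=
  adjoin i (iter_preimage i f n a).

(* The number of cosets gH with g in G; 0 when there are infinitely many. *)
Definition mul_index (R : realType) (G H : set R) : nat :=
  #|` fset_set [set [set g * h | h in H] | g in G] |%fset.

(* e(E/K), as the index of the value group of K in that of E. *)
Definition ramification_index (R : realType) (K L : fieldType)
  (v : absval R K) (w : absval R L) (E : set L) : nat :=
  mul_index (value_group w E) (value_group v setT).

(* Main.v *)
(* Since the critical points have bounded orbits they are integral, so all
   coefficients of f' are divisible by d, hence by p.  Take two points x, y of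
   f^{-n}(a) with |p| < |x - y| < 1, and x' with f(x') = x.  The roots of
   f(x' + z) = y satisfy prod |z| = |x - y| > |p|, while the coefficient of z^k in
   f(x' + z) is divisible by p when p does not divide k.  Hence the abscissae of
   the vertices of the Newton polygon of f(x' + z) - y are multiples of p, i.e.
   every value |z| is attained a multiple of p times, and |x - y| is a product of
   p-th powers of distances |z| between two points of f^{-(n+1)}(a).  Iterating, the
   fixed value |x - y| is a p^k-th power in the value group of K_{n+k}, which
   forces p^k to divide a fixed multiple of e(K_{n+k}/K).  Such a pair x, y is found
   by pulling back two distinct roots of f(z) = a in the same residue class:
   this can be done so that the distance grows from |x - y| to at least
   |x - y|^{1/2}. *)
Require Import Defs.
From HB Require Import structures.
From mathcomp Require Import all_boot all_order all_algebra finmap.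
From mathcomp Require Import all_classical all_reals all_analysis.

From mathcomp Require Import separable ring.
Set Implicit Arguments.
Unset Strict Implicit.
Unset Printing Implicit Defensive.

Import Order.TTheory GRing.Theory Num.Theory.
Import numFieldNormedType.Exports.

Local Open Scope classical_set_scope.
Local Open Scope ring_scope.

(** * Nonarchimedean absolute values and the Newton polygon *)

Section AbsvalTheory.
Variables (R : realType) (F : fieldType) (w : absval R F).

Lemma absval0 : w 0 = 0.
Proof. by apply/absval_eq0. Qed.

Lemma absval_gt0 x : (0 < w x) = (x != 0).
Proof.
rewrite lt_neqAle absval_ge0 andbT eq_sym.
by congr (~~ _); apply/eqP/eqP; case: (absval_eq0 w x).
Qed.

Lemma absval1 : w 1 = 1.
Proof.
have w1 : w 1 != 0 by rewrite gt_eqF // absval_gt0 oner_neq0.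
by apply: (mulfI w1); rewrite -absvalM !mulr1.
Qed.

Lemma absvalX x n : w (x ^+ n) = w x ^+ n.
Proof.
by elim: n => [|n IHn]; rewrite ?expr0 ?absval1 // !exprS absvalM IHn.
Qed.

Lemma absval_prod (I : Type) (r : seq I) (P : pred I) (G : I -> F) :
  w (\prod_(k <- r | P k) G k) = \prod_(k <- r | P k) w (G k).
Proof. exact: (big_morph w (absvalM w) absval1). Qed.

Lemma absvalN x : w (- x) = w x.
Proof.
have wN1 : w (- 1) = 1.
  apply/eqP; rewrite -(@eqrXn2 _ 2) ?absval_ge0 ?ler01 //.
  by rewrite -absvalX sqrrN !expr1n absval1.
by rewrite -mulN1r absvalM wN1 mul1r.
Qed.

Lemma absvalV x : w x^-1 = (w x)^-1.
Proof.
have [->|x0] := eqVneq x 0; first by rewrite invr0 absval0 invr0.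
have wx0 : w x != 0 by rewrite gt_eqF ?absval_gt0.
by apply: (mulfI wx0); rewrite -absvalM !divff ?absval1.
Qed.

Lemma absvalD_le x y r : w x <= r -> w y <= r -> w (x + y) <= r.
Proof.
by move=> xr yr; apply: le_trans (absval_ultra w x y) _; rewrite ge_max xr.
Qed.

Lemma absvalD_lt x y r : w x < r -> w y < r -> w (x + y) < r.
Proof.
by move=> xr yr; apply: le_lt_trans (absval_ultra w x y) _; rewrite gt_max xr.
Qed.

Lemma absvalD_eq x y : w x < w y -> w (x + y) = w y.
Proof.
move=> xy; apply/le_anti; rewrite absvalD_le ?lexx ?(ltW xy) //=.
rewrite leNgt; apply/negP => lt_xy.
have := @absvalD_lt (x + y) (- x) (w y) lt_xy.
by rewrite absvalN xy addrAC subrr add0r ltxx => /(_ isT).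
Qed.

Lemma absval_sum_le (I : Type) (s : seq I) (P : pred I) (G : I -> F) r :
  0 <= r -> (forall k, P k -> w (G k) <= r) ->
  w (\sum_(k <- s | P k) G k) <= r.
Proof.
move=> r0 Gr; elim/big_ind: _ => //; first by rewrite absval0.
by move=> x y; apply: absvalD_le.
Qed.

Lemma absval_nat n : w n%:R <= 1.
Proof.
by elim: n => [|n IHn]; rewrite ?absval0 ?ler01 // -natr1 absvalD_le ?absval1.
Qed.

(** If both [k] and [p] had value below 1, a Bezout relation between these coprime integers would
    give 1 a value below 1. *)
Lemma absval_nat_prime p k : prime p -> w p%:R < 1 -> ~~ (p %| k)%N ->
  w k%:R = 1.
Proof.
move=> p_pr wp pk; apply/le_anti; rewrite absval_nat /= leNgt.
apply/negP => wk.
have k0 : (0 < k)%N by case: k pk {wk}; rewrite ?dvdn0.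
have [km kn def _] := egcdnP p k0.
have gcd1 : gcdn k p = 1%N.
  by apply/eqP; rewrite -/(coprime k p) coprime_sym prime_coprime.
have /(congr1 (fun n : nat => n%:R : F)) := def.
rewrite gcd1 natrD !natrM => def1.
have : w (km%:R * k%:R - kn%:R * p%:R) < 1.
  apply: absvalD_lt; rewrite ?absvalN absvalM.
    by apply: le_lt_trans wk; rewrite ler_piMl ?absval_ge0 ?absval_nat.
  by apply: le_lt_trans wp; rewrite ler_piMl ?absval_ge0 ?absval_nat.
by rewrite def1 addrAC subrr add0r absval1 ltxx.
Qed.

(** Nonzero terms of pairwise distinct values cannot cancel, since the largest one dominates. *)
Lemma absval_sum_distinct (I : eqType) (s : seq I) (G : I -> F) :
  uniq s ->
  {in s &, forall k l, G k != 0 -> w (G k) = w (G l) -> k = l} ->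
  \sum_(k <- s) G k = 0 -> {in s, forall k, G k = 0}.
Proof.
pose Z (t : seq I) := {in t, forall k, G k = 0}.
move=> us inj_s sum0.
(* The claim is strengthened for the induction: a sum with some nonzero term has the value of one of
   its nonzero terms. *)
suff [] : Z s \/ exists2 k, k \in s & G k != 0 /\ w (\sum_(k <- s) G k) = w (G k).
- by [].
- case=> k _ [Gk0]; rewrite sum0 absval0 => /esym wG.
  by move: Gk0; rewrite -absval_gt0 wG ltxx.
move: us inj_s {sum0}; elim: s => [|k s IHs] /=; first by left.
case/andP=> ks us inj_s.
have [] := IHs us.
- by move=> x y xs ys; apply: inj_s; rewrite inE ?xs ?ys orbT.
- move=> Zs; have S0 : \sum_(l <- s) G l = 0.
    by rewrite big_seq big1.
  have [Gk0|Gk0] := eqVneq (G k) 0.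
    by left=> l; rewrite inE => /predU1P[->|/Zs].
  by right; exists k; rewrite ?mem_head // big_cons S0 addr0.
- case=> l ls [Gl0 Sl]; right.
  have lks : l \in k :: s by rewrite inE ls orbT.
  rewrite big_cons; have [Gk0|Gk0] := eqVneq (G k) 0.
    by exists l; rewrite // Gk0 add0r.
  have kl : w (G k) != w (G l).
    apply: contraNneq ks => /inj_s -> //; exact: mem_head.
  case: (ltgtP (w (G k)) (w (G l))) kl => // lt_kl _.
    by exists l; rewrite // -Sl absvalD_eq // Sl.
  exists k; first exact: mem_head.
  by rewrite addrC absvalD_eq // Sl.
Qed.

(* The Newton polygon, read off at the vertex separating the roots in the open
   disk of radius [r] from the others. *)
Lemma prod_XsubC_coef (zs : seq F) (r : R) (r_gt0 : 0 < r) :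
  let g := \prod_(z <- zs) ('X - z%:P) in
  let A := count (fun z => w z < r) zs in
  let P := \prod_(z <- zs | r <= w z) w z in
  [/\ forall k, w g`_k * r ^+ k <= P * r ^+ A,
      forall k, (k < A)%N -> w g`_k * r ^+ k < P * r ^+ A &
      w g`_A = P].
Proof.
rewrite /=; elim: zs => [|z zs].
  rewrite !big_nil /= expr0; split=> // [k|]; last by rewrite coef1 absval1.
  rewrite coef1; case: k => [|k]; rewrite ?absval1 ?expr0 ?mulr1 //.
  by rewrite absval0 mul0r.
rewrite !big_cons /=.
set g := \prod_(_ <- _) _; set A := count _ _; set P := \prod_(_ <- _ | _) _.
case=> le_g lt_g eq_g.
have coefg k : (('X - z%:P) * g)`_k.+1 = g`_k - z * g`_k.+1.
  by rewrite mulrBl coefB coefXM coefCM.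
have coefg0 : (('X - z%:P) * g)`_0 = 0 - z * g`_0.
  by rewrite mulrBl coefB coefXM coefCM.
have P_gt0 : 0 < P.
  by apply: prodr_gt0 => x; apply: lt_le_trans.
have PrA_gt0 : 0 < P * r ^+ A by rewrite mulr_gt0 ?exprn_gt0.
have PrS : P * r ^+ A.+1 = r * (P * r ^+ A) by rewrite exprS mulrCA.
have lshift k : w g`_k * r ^+ k.+1 <= P * r ^+ A.+1.
  by rewrite !exprSr !mulrA ler_wpM2r ?(ltW r_gt0).
(* A new root with [w z < r] moves the vertex from [A] to [A.+1]; any other root leaves [A] in place
   and multiplies [P] by [w z]. At the vertex one of the two terms of the new coefficient strictly
   dominates. *)
case: ltP => [zr|rz] /=.
  have zg k : w (z * g`_k) * r ^+ k < P * r ^+ A.+1.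
    rewrite absvalM -mulrA PrS.
    apply: le_lt_trans (_ : w z * (P * r ^+ A) < _).
      by rewrite ler_wpM2l ?absval_ge0.
    by rewrite ltr_pM2r.
  split.
  - case=> [|k].
      by rewrite coefg0 sub0r absvalN (ltW (zg _)).
    rewrite -ler_pdivlMr ?exprn_gt0 // coefg absvalD_le //.
      by rewrite ler_pdivlMr ?exprn_gt0.
    by rewrite absvalN ler_pdivlMr ?exprn_gt0 // ltW.
  - case=> [_|k kA].
      by rewrite coefg0 sub0r absvalN zg.
    rewrite -ltr_pdivlMr ?exprn_gt0 // coefg absvalD_lt //.
      rewrite ltr_pdivlMr ?exprn_gt0 // !exprSr !mulrA ltr_pM2r //.
      exact: lt_g.
    by rewrite absvalN ltr_pdivlMr ?exprn_gt0.
  - rewrite add1n coefg addrC absvalD_eq // absvalN eq_g.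
    by move: (zg A.+1); rewrite ltr_pM2r ?exprn_gt0.
rewrite add0n.
have z_gt0 : 0 < w z := lt_le_trans r_gt0 rz.
have shift k : w g`_k * r ^+ k.+1 <= w z * P * r ^+ A.
  apply: le_trans (lshift k) _.
  by rewrite PrS -mulrA ler_pM2r.
have lt_shift k : (k < A)%N -> w g`_k * r ^+ k.+1 < w z * P * r ^+ A.
  move=> kA; apply: lt_le_trans (_ : r * (P * r ^+ A) <= _).
    by rewrite exprS mulrCA ltr_pM2l ?lt_g.
  by rewrite -mulrA ler_pM2r.
split.
- case=> [|k].
    by rewrite coefg0 sub0r absvalN absvalM -!mulrA ler_pM2l // le_g.
  rewrite -ler_pdivlMr ?exprn_gt0 // coefg absvalD_le //.
    by rewrite ler_pdivlMr ?exprn_gt0.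
  by rewrite absvalN ler_pdivlMr ?exprn_gt0 // absvalM -!mulrA ler_pM2l // le_g.
- case=> [A0|k kA].
    by rewrite coefg0 sub0r absvalN absvalM -!mulrA ltr_pM2l // lt_g.
  rewrite -ltr_pdivlMr ?exprn_gt0 // coefg absvalD_lt //.
    by rewrite ltr_pdivlMr ?exprn_gt0 // lt_shift // ltnW.
  by rewrite absvalN ltr_pdivlMr ?exprn_gt0 // absvalM -!mulrA ltr_pM2l // lt_g.
- case EA: A => [|k]; first by rewrite coefg0 sub0r absvalN absvalM -EA eq_g.
  have wzg : w (- (z * g`_k.+1)) = w z * P by rewrite absvalN absvalM -EA eq_g.
  rewrite coefg absvalD_eq wzg //.
  have := lt_shift k; rewrite EA ltnSn => /(_ isT).
  by rewrite ltr_pM2r ?exprn_gt0.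
Qed.

End AbsvalTheory.

(** * Subgroups of the positive reals: index and p-th powers *)

Section MultiplicativeIndex.
Variable R : realType.

Definition pos_subgroup (G : set R) : Prop :=
  [/\ G 1, forall x y, G x -> G y -> G (x / y) & forall x, G x -> 0 < x].

Lemma pos_subgroupM (G : set R) x y :
  pos_subgroup G -> G x -> G y -> G (x * y).
Proof.
case=> G1 Gdiv _ Gx Gy; rewrite -[y]invrK -[y^-1]mul1r.
by do 2?apply: (Gdiv).
Qed.

Lemma pos_subgroupX (G : set R) x n : pos_subgroup G -> G x -> G (x ^+ n).
Proof.
move=> sG Gx; elim: n => [|n IHn]; first by rewrite expr0; case: sG.
by rewrite exprS; apply: pos_subgroupM.
Qed.

Lemma coset_eqP (H : set R) x y : pos_subgroup H -> 0 < x -> 0 < y ->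
  [set x * h | h in H] = [set y * h | h in H] <-> H (x / y).
Proof.
move=> sH x0 y0; have [H1 Hdiv _] := sH.
have [xn0 yn0] : x != 0 /\ y != 0 by rewrite !gt_eqF.
split=> [|Hxy].
  move=> /seteqP[/(_ x)]; case; first by exists 1; rewrite ?mulr1.
  by move=> h Hh <- _; rewrite mulrC mulKf.
apply/seteqP; split=> _ [h Hh <-].
  exists (x / y * h); first exact: pos_subgroupM.
  by rewrite mulrA mulrCA divff // mulr1.
exists (h / (x / y)); first exact: Hdiv.
by field; rewrite xn0 yn0.
Qed.

(* Multiplication by [g] permutes the finitely many cosets, so multiplying
   representatives of all of them gives Lagrange's theorem. *)
Lemma mul_index_exp (G H : set R) g :
  pos_subgroup G -> pos_subgroup H -> H `<=` G ->
  finite_set [set [set g * h | h in H] | g in G] ->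
  G g -> H (g ^+ mul_index G H).
Proof.
move=> sG sH HG finQ Gg; rewrite /mul_index.
set Q := [set _ | _ in G] in finQ *; set s := fset_set Q.
have [G1 Gdiv Gpos] := sG; have [H1 Hdiv Hpos] := sH.
have sQ q : (q \in enum_fset s) = (q \in Q) by rewrite -in_fset_set.
pose coset x := [set x * h | h in H].
pose rep (q : set R) := xget 1 q.
have repP q : q \in Q -> G (rep q) /\ coset (rep q) = q.
  move=> /set_mem[x Gx <-]; have : coset x (rep (coset x)).
    by apply: (@xgetI _ _ _ x); exists 1; rewrite ?mulr1.
  case=> h Hh; rewrite -/(coset x) => def_r; rewrite -def_r; split.
    by apply: pos_subgroupM => //; apply: HG.
  apply/coset_eqP; rewrite ?mulr_gt0 ?(Hpos _ Hh) ?Gpos //.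
  by rewrite mulrC mulKf // gt_eqF ?Gpos.
pose phi q := coset (g * rep q).
have phiQ q : q \in Q -> phi q \in Q.
  move=> /repP[Gr _]; apply/mem_set; exists (g * rep q) => //.
  exact: pos_subgroupM.
have g0 : 0 < g := Gpos _ Gg.
have phi_inj : {in Q &, injective phi}.
  move=> q1 q2 /repP[Gr1 def1] /repP[Gr2 def2] /coset_eqP.
  move=> /(_ sH); rewrite !mulr_gt0 ?Gpos // => /(_ isT isT).
  rewrite -mulf_div divff ?gt_eqF // mul1r => Hr.
  by rewrite -def1 -def2; apply/coset_eqP; rewrite ?Gpos.
have perm_phi : perm_eq (map phi s) s.
  have us : uniq (map phi s).
    by rewrite map_inj_in_uniq ?fset_uniq // => q1 q2; rewrite !sQ; apply: phi_inj.
  have sub : {subset map phi s <= s}.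
    by move=> _ /mapP[q + ->]; rewrite !sQ; apply: phiQ.
  have szs : (size (enum_fset s) <= size (map phi s))%N by rewrite size_map.
  by apply: uniq_perm; rewrite ?fset_uniq //; case: (uniq_min_size us sub szs).
have rep0 q : q \in enum_fset s -> rep q != 0.
  by rewrite sQ => /repP[/Gpos]; rewrite lt0r => /andP[].
set e := #|` _|%fset.
have prod0 : \prod_(q <- s) rep q != 0.
  by rewrite prodf_seq_neq0; apply/allP => q /rep0.
(* In the product of these quotients the representatives cancel, because [phi] permutes the cosets;
   only the power of [g] is left. *)
suff : H (\prod_(q <- s) (g * rep q / rep (phi q))).
  rewrite prodf_div big_split /= -(big_map phi predT rep) (perm_big _ perm_phi) /=.
  by rewrite mulfK // big_const_seq count_predT iter_mulr_1.
rewrite big_seq; apply: (big_ind H) => // [x y|q]; first exact: pos_subgroupM.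
rewrite sQ => Qq; have [Gr _] := repP _ Qq; have [Gr' def'] := repP _ (phiQ _ Qq).
by apply/coset_eqP; rewrite ?mulr_gt0 ?Gpos // -/(coset _) def'.
Qed.

Lemma mul_index_gt0 (G H : set R) :
  finite_set [set [set g * h | h in H] | g in G] -> G 1 ->
  (0 < mul_index G H)%N.
Proof.
move=> finQ G1; rewrite /mul_index cardfs_gt0; apply/fset0Pn.
exists [set 1 * h | h in H]; rewrite in_fset_set //.
by apply/mem_set; exists 1.
Qed.

(** The multiplicity of [r] is the difference of the counts below two radii that enclose no other
    entry. *)
Lemma dvdn_count_mem (p : nat) (s : seq R) :
  (forall r, 0 < r -> (p %| count (< r) s)%N) ->
  forall r, 0 < r -> (p %| count_mem r s)%N.
Proof.
move=> dvd_lt r r0.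
have [r' rr' le_r] : exists2 r', r < r' & {in s, forall x, (x < r') = (x <= r)}.
  elim: s {dvd_lt} => [|x s [r' rr' IHs]]; first by exists (r + 1); rewrite ?ltrDl.
  case: (leP x r) => [xr|rx].
    exists r' => // y; rewrite inE => /predU1P[->|/IHs //].
    by rewrite xr (le_lt_trans xr).
  exists (Num.min x r') => [|y]; first by rewrite lt_min rx.
  rewrite inE lt_min => /predU1P[->|ys].
    by rewrite ltxx leNgt rx.
  by rewrite IHs //; case: (leP y r) => [/le_lt_trans/(_ rx)->|]; rewrite ?andbF.
have : (p %| count (< r') s)%N by apply/dvd_lt/(lt_trans r0).
suff -> : count (< r') s = (count (< r) s + count_mem r s)%N.
  by rewrite dvdn_addr ?dvd_lt.
rewrite (eq_in_count le_r) -count_predUI [X in (_ + X)%N](_ : _ = 0%N); last first.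
  by apply/eqP; rewrite -leqn0 leqNgt -has_count; apply/hasPn => x _ /=; case: ltgtP.
by rewrite addn0; apply: eq_count => x /=; case: ltgtP.
Qed.

(** Equal factors are grouped: a value [g ^+ q] occurring [c * p] times contributes the [q * p]-th
    power of [g ^+ c]. *)
Lemma prod_pow_dvdn_count (G : set R) (p q : nat) (s : seq R) :
  pos_subgroup G ->
  {in s, forall r, (p %| count_mem r s)%N} ->
  {in s, forall r, exists2 g, G g & g ^+ q = r} ->
  exists2 g, G g & g ^+ (q * p) = \prod_(r <- s) r.
Proof.
move=> sG dvd_s pow_s; rewrite -prodr_undup_exp_count big_seq.
apply: (big_ind (fun x => exists2 g, G g & g ^+ (q * p) = x)).
- by exists 1; rewrite ?expr1n //; case: sG.
- move=> _ _ [g Gg <-] [h Gh <-].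
  by exists (g * h); rewrite ?exprMn //; apply: pos_subgroupM.
- move=> r; rewrite mem_undup => rs; have [g Gg gr] := pow_s r rs.
  have /dvdnP[c ->] := dvd_s r rs.
  exists (g ^+ c); first exact: pos_subgroupX.
  by rewrite -gr -!exprM mulnCA.
Qed.

End MultiplicativeIndex.

(** * Finite extensions have finite ramification index *)

Section AdjoinFiniteDegree.
Variables (K : fieldType) (L : fieldType) (i : {rmorphism K -> L}).
Local Notation "q ^i" := (map_poly i q) (at level 2, format "q ^i").

(** Factors ['X] are removed until the constant coefficient [c] is nonzero; then [P(y) y + c = 0]
    exhibits the inverse as [- P(y) / c]. *)
Lemma inv_horner_algebraic (P : {poly K}) (y : L) :
  P != 0 -> root P^i y -> y != 0 -> exists q, y^-1 = q^i.[y].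
Proof.
move=> + + y0; elim/poly_ind: P => [|P c IHP]; first by rewrite eqxx.
rewrite /root rmorphD rmorphM /= map_polyX map_polyC /= !hornerE.
have [->|c0] := eqVneq c 0.
  rewrite polyC0 addr0 rmorph0 addr0 => PX0.
  rewrite mulf_eq0 (negbTE y0) orbF; apply: IHP.
  by apply: contraNneq PX0 => ->; rewrite mul0r.
move=> _ /eqP eq0; exists (- (c^-1 *: P)).
have ic0 : i c != 0 by rewrite fmorph_eq0.
rewrite rmorphN /= map_polyZ /= fmorphV hornerN hornerZ.
apply: (mulIf y0); apply: (mulfI ic0).
rewrite mulVf // mulr1 mulNr mulrN -mulrA mulVKf //.
by apply/eqP; rewrite -subr_eq0 opprK addrC eq0.
Qed.

(** Membership in the ring K[t], which is the field K(t) for algebraic [t]. *)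
Definition poly_in (t x : L) := exists q : {poly K}, x = q^i.[t].

Lemma poly_in_horner t x (q : {poly K}) : poly_in t x -> poly_in t q^i.[x].
Proof.
by case=> r ->; exists (q \Po r); rewrite map_comp_poly horner_comp.
Qed.

Hypothesis (Kchar0 : [pchar K] =i pred0) (i_alg : integralRange i).

Lemma poly_in_closed t : divring_closed (mem [set x | poly_in t x]).
Proof.
split.
- by apply/mem_set; exists 1; rewrite rmorph1 hornerC.
- move=> _ _ /set_mem[q ->] /set_mem[r ->]; apply/mem_set.
  by exists (q - r); rewrite rmorphB hornerD hornerN.
- move=> x y /set_mem[q ->] /set_mem yt; apply/mem_set.
  have [r ->] : poly_in t y^-1.
    have [->|y0] := eqVneq y 0.
      by exists 0; rewrite invr0 rmorph0 horner0.
    have [P P_mon Py] := i_alg y.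
    have [s ->] := inv_horner_algebraic (monic_neq0 P_mon) Py y0.
    exact: poly_in_horner.
  by exists (q * r); rewrite rmorphM hornerM.
Qed.

Lemma primitive_element (s : seq L) :
  exists t, {in s, forall x, poly_in t x}.
Proof.
elim: s => [|x s [t IHs]]; first by exists 0.
have [P P_mon Px] := i_alg x; have [Q Q_mon Qt] := i_alg t.
have [n [[q Dx] [r Dt]]] :=
  pchar0_PET (monic_neq0 P_mon) Px (monic_neq0 Q_mon) Qt Kchar0.
exists (t *+ n - x) => y; rewrite inE => /predU1P[->|/IHs[h ->]].
  by exists q.
by apply: poly_in_horner; exists r.
Qed.

(** Reduction modulo a polynomial annihilating a primitive element bounds the degree. The uniform
    [N] stands in for the dimension over K. *)
Lemma adjoin_sub_poly (S : set L) (s : seq L) : S `<=` [set` s] ->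
  exists t N, forall x, adjoin i S x ->
    exists2 q : {poly K}, (size q <= N)%N & x = q^i.[t].
Proof.
move=> Ss; have [t ts] := primitive_element s.
have [P P_mon Pt] := i_alg t.
exists t, (size P) => x /(_ [set x | poly_in t x]) [].
  split; first exact: poly_in_closed.
  move=> y [[c _ <-]|/Ss/ts //].
  by exists c%:P; rewrite map_polyC hornerC.
move=> q ->; exists (q %% P); first by rewrite ltnW // ltn_modp monic_neq0.
rewrite [in LHS](divp_eq q P) rmorphD rmorphM hornerD hornerM.
by move/rootP: Pt => ->; rewrite mulr0 add0r.
Qed.

Lemma adjoin_closed (S : set L) : divring_closed (mem (adjoin i S)).
Proof.
split.
- by apply/mem_set => E [[/set_mem]].
- move=> x y /set_mem xS /set_mem yS; apply/mem_set => E [clE SE].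
  have [_ Esub _] := clE.
  by apply/set_mem/Esub; apply/mem_set; [apply: xS | apply: yS].
- move=> x y /set_mem xS /set_mem yS; apply/mem_set => E [clE SE].
  have [_ _ Ediv] := clE.
  by apply/set_mem/Ediv; apply/mem_set; [apply: xS | apply: yS].
Qed.

Lemma sub_adjoin (S : set L) : S `<=` adjoin i S.
Proof. by move=> x Sx E [_ SE]; apply: SE; right. Qed.

Lemma range_sub_adjoin (S : set L) x : adjoin i S (i x).
Proof. by move=> E [_ SE]; apply: SE; left; exists x. Qed.

Variables (R : realType) (v : absval R K) (w : absval R L).
Hypothesis wv : absval_extends v w i.

Lemma value_group_closed (E : set L) : divring_closed (mem E) ->
  pos_subgroup (value_group w E).
Proof.
case=> [/set_mem E1 _ Ediv]; split.
- by exists 1; rewrite ?absval1 //; split; rewrite //= oner_neq0.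
- move=> _ _ [x [Ex x0] <-] [y [Ey y0] <-]; exists (x / y).
    split; last by rewrite /= mulf_neq0 ?invr_eq0.
    by apply/set_mem/Ediv; apply/mem_set.
  by rewrite absvalM absvalV.
- by move=> _ [x [_ x0] <-]; rewrite absval_gt0.
Qed.

Lemma value_group_base : pos_subgroup (value_group v setT).
Proof.
split.
- by exists 1; rewrite ?absval1 //; split; rewrite //= oner_neq0.
- move=> _ _ [x [_ x0] <-] [y [_ y0] <-]; exists (x / y).
    by split; rewrite //= mulf_neq0 ?invr_eq0.
  by rewrite absvalM absvalV.
- by move=> _ [x [_ x0] <-]; rewrite absval_gt0.
Qed.

(** This is the inequality between ramification index and degree: elements whose values lie in
    distinct cosets are linearly independent over K, so there are at most [N] cosets. *)
Lemma finite_value_cosets (E : set L) (t : L) (N : nat) :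
  (forall x, E x -> exists2 q : {poly K}, (size q <= N)%N & x = q^i.[t]) ->
  finite_set [set [set g * h | h in value_group v setT] | g in value_group w E].
Proof.
move=> E_poly; apply: contrapT => /(@infinite_set_fset _ _ N.+1)[B BQ szB].
have /choice[q qP] : forall k : 'I_(#|` B|), exists q : {poly K},
    [/\ (size q <= N)%N, q^i.[t] != 0 &
     [set w q^i.[t] * h | h in value_group v setT] = nth set0 B k].
  move=> k; have /BQ[_ [x [Ex x0] <-] <-] : nth set0 B k \in B.
    exact: mem_nth.
  by have [q szq def_x] := E_poly x Ex; exists q; rewrite -def_x.
pose M := \matrix_(k < #|` B|, l < N) (q k)`_l.
(* The coefficient matrix has more than [N] rows and only [N] columns, so its rows satisfy a
   nontrivial relation [c]. *)
have : kermx M != 0.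
  rewrite kermx_eq0 /row_free neq_ltn.
  by rewrite (leq_ltn_trans (rank_leq_col M)).
case/rowV0Pn=> c /sub_kermxP cM0 c0.
have sum0 : \sum_(k < #|` B|) i (c 0 k) * (q k)^i.[t] = 0.
  have : (\sum_k c 0 k *: q k)^i.[t] = 0.
    suff -> : \sum_k c 0 k *: q k = 0 by rewrite rmorph0 horner0.
    apply/polyP => l; rewrite coef0 coef_sum.
    have [lN|Nl] := ltnP l N; last first.
      rewrite big1 // => k _; rewrite coefZ nth_default ?mulr0 //.
      by have [szq _ _] := qP k; apply: leq_trans Nl.
    move/matrixP/(_ 0 (Ordinal lN)): cM0; rewrite !mxE => cMl; rewrite -[RHS]cMl.
    by apply: eq_bigr => k _; rewrite coefZ mxE.
  rewrite rmorph_sum /= horner_sum => cq0; rewrite -[RHS]cq0.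
  by apply: eq_bigr => k _; rewrite map_polyZ hornerZ.
case/negP: c0; apply/eqP/rowP => k; rewrite mxE.
have sB := value_group_base.
have ntq j : (q j)^i.[t] != 0 by have [] := qP j.
(* Scaling by [c] does not change the coset of a value, so the nonzero terms of the relation have
   distinct values and every [c 0 k] vanishes. *)
suff /(absval_sum_distinct (index_enum_uniq _))/(_ sum0 k (mem_index_enum k)) :
    {in index_enum 'I_(#|` B|) &, forall k1 k2,
      i (c 0 k1) * (q k1)^i.[t] != 0 ->
      w (i (c 0 k1) * (q k1)^i.[t]) = w (i (c 0 k2) * (q k2)^i.[t]) -> k1 = k2}.
  by move/eqP; rewrite mulf_eq0 (negbTE (ntq k)) orbF fmorph_eq0 => /eqP.
move=> k1 k2 _ _.
rewrite mulf_eq0 (negbTE (ntq k1)) orbF fmorph_eq0 !absvalM !wv => c1 eqw.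
apply/val_inj/eqP; rewrite -(nth_uniq set0 (ltn_ord k1) (ltn_ord k2)) ?fset_uniq //.
have [_ _ <-] := qP k1; have [_ _ <-] := qP k2.
apply/eqP/(coset_eqP sB); rewrite ?absval_gt0 //.
have c2 : c 0 k2 != 0.
  apply: contra_eq_neq eqw => ->.
  by rewrite absval0 mul0r mulf_neq0 // gt_eqF ?absval_gt0.
exists (c 0 k2 / c 0 k1); first by split; rewrite //= mulf_neq0 ?invr_eq0.
rewrite absvalM absvalV.
have v1 : v (c 0 k1) != 0 by rewrite gt_eqF ?absval_gt0.
have w2 : w (q k2)^i.[t] != 0 by rewrite gt_eqF ?absval_gt0.
by apply/eqP; rewrite eqr_div // -eqw mulrC.
Qed.

End AdjoinFiniteDegree.

(** * Polynomials with bounded coefficients, and growth outside the unit disk *)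

Section IntegralPolynomials.
Variables (R : realType) (L : fieldType) (w : absval R L).

Definition coefs_le (r : R) (q : {poly L}) := forall k, w q`_k <= r.

Lemma coefs_leM r q1 q2 : 0 <= r -> coefs_le r q1 -> coefs_le 1 q2 ->
  coefs_le r (q1 * q2).
Proof.
move=> r0 q1r q2r k; rewrite coefM absval_sum_le // => l _.
by rewrite absvalM -[r]mulr1 ler_pM ?absval_ge0.
Qed.

Lemma coefs_leC r c : 0 <= r -> w c <= r -> coefs_le r c%:P.
Proof. by move=> r0 cr k; rewrite coefC; case: eqP; rewrite ?absval0. Qed.

Lemma coefs_le_XaddC x : w x <= 1 -> coefs_le 1 ('X + x%:P).
Proof.
move=> x1 k; rewrite coefD absvalD_le ?coefs_leC ?ler01 //.
by rewrite coefX; case: eqP; rewrite ?absval1 ?absval0 ?ler01.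
Qed.

Lemma coefs_le_comp_XaddC r q x : 0 <= r -> w x <= 1 -> coefs_le r q ->
  coefs_le r (q \Po ('X + x%:P)).
Proof.
move=> r0 x1 qr k; rewrite comp_polyE coef_sum absval_sum_le // => l _.
rewrite -mul_polyC; apply: coefs_leM => //; first exact: coefs_leC.
elim: (l : nat) => [|n IHn].
  by rewrite expr0; apply: coefs_leC; rewrite ?absval1.
by rewrite exprS; apply: coefs_leM => //; apply: coefs_le_XaddC.
Qed.

Lemma coefs_le_prod_XsubC (cs : seq L) : {in cs, forall c, w c <= 1} ->
  coefs_le 1 (\prod_(c <- cs) ('X - c%:P)).
Proof.
move=> cs1; rewrite big_seq; elim/big_ind: _ => [|q1 q2|c /cs1 c1].
- by apply: coefs_leC; rewrite ?absval1.
- exact: coefs_leM.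
- by rewrite -polyCN; apply: coefs_le_XaddC; rewrite absvalN.
Qed.

(** Outside the unit disk the leading term strictly dominates all the others. *)
Lemma horner_monic_large (F : {poly L}) d x : F \is monic -> size F = d.+1 ->
  coefs_le 1 F -> 1 < w x -> w F.[x] = w x ^+ d.
Proof.
move=> F_mon szF F1 x1; have x0 := lt_trans ltr01 x1.
rewrite horner_coef szF big_ord_recr /=.
have -> : F`_d = 1 by move/monicP: F_mon; rewrite lead_coefE szF.
rewrite mul1r absvalD_eq absvalX //.
elim/big_ind: _ => [|y z|k _]; first by rewrite absval0 exprn_gt0.
  exact: absvalD_lt.
rewrite absvalM absvalX; apply: le_lt_trans (_ : w x ^+ k < _).
  by rewrite ler_piMl ?exprn_ge0 ?absval_ge0 //; apply: F1.
by rewrite ltr_eXn2l.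
Qed.

(** Bernoulli's inequality combined with the archimedean property. *)
Lemma exprn_unbounded (c M : R) : 1 < c -> exists n, M < c ^+ n.
Proof.
move=> c1; have h0 : 0 < c - 1 by rewrite subr_gt0.
have bernoulli n : n%:R * (c - 1) <= c ^+ n.
  elim: n => [|n IHn]; first by rewrite mul0r expr0 ler01.
  have : 1 <= c ^+ n by rewrite exprn_ege1 // ltW.
  rewrite exprS -natr1 => cn1; rewrite mulrDl mul1r.
  have -> : c * c ^+ n = c ^+ n + (c - 1) * c ^+ n by ring.
  by rewrite lerD // ler_peMr // ltW.
have [M0|M0] := leP M 0.
  by exists 0; rewrite expr0 (le_lt_trans M0) ?ltr01.
exists (Num.bound (M / (c - 1))); apply: lt_le_trans (bernoulli _).
by rewrite -ltr_pdivrMr // archi_boundP // divr_ge0 // ltW.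
Qed.

End IntegralPolynomials.

(** * Pulling pairs of points back along F *)

Definition level (L : fieldType) (F : {poly L}) (a : L) n x : Prop :=
  iter n (horner F) x = a.

Section Pullback.
Variables (R : realType) (L : closedFieldType) (w : absval R L).
Variables (p d : nat) (F : {poly L}).
Hypotheses (p_pr : prime p) (wp1 : w p%:R < 1) (p_dvd_d : (p %| d)%N).
Hypotheses (F_mon : F \is monic) (szF : size F = d.+1) (d_gt0 : (0 < d)%N).
Hypothesis F_int : coefs_le w 1 F.

Lemma monic_split (q : {poly L}) : q \is monic ->
  exists rs, q = \prod_(t <- rs) ('X - t%:P).
Proof.
move=> q_mon; have [rs def_q] := closed_field_poly_normal q.
by exists rs; rewrite {1}def_q (monicP q_mon) scale1r.
Qed.

Lemma root_prod_XsubC_seq (rs : seq L) x :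
  ((\prod_(t <- rs) ('X - t%:P)).[x] == 0) = (x \in rs).
Proof. by rewrite -root_prod_XsubC. Qed.

(** Over L the derivative is [d] times the product of the ['X - c%:P] over integral critical points,
    and p divides [d]. That [d] is nonzero in L makes [d] the leading coefficient. *)
Lemma coefs_le_deriv : d%:R != 0 :> L -> (forall c, root F^`() c -> w c <= 1) ->
  coefs_le w (w p%:R) F^`().
Proof.
move=> d0 crit1.
have coef_d : F^`()`_d.-1 = d%:R.
  rewrite coef_deriv prednK //; move/monicP: F_mon.
  by rewrite lead_coefE szF /= => ->.
have szF' : size F^`() = d.
  apply/eqP; rewrite eqn_leq; apply/andP; split.
    by rewrite -ltnS -szF lt_size_deriv // monic_neq0.
  rewrite leqNgt; apply/negP => szF'; move: d0; rewrite -coef_d nth_default ?eqxx //.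
  by rewrite -ltnS prednK.
have [cs def_F'] := closed_field_poly_normal F^`().
rewrite lead_coefE szF' coef_d -mul_polyC in def_F'.
rewrite def_F'; apply: coefs_leM; rewrite ?absval_ge0 //.
  apply: coefs_leC; rewrite ?absval_ge0 //.
  have /dvdnP[m ->] := p_dvd_d.
  by rewrite natrM absvalM ler_piMl ?absval_ge0 ?absval_nat.
apply: coefs_le_prod_XsubC => c cs_c; apply: crit1.
by rewrite def_F' rootM root_prod_XsubC cs_c orbT.
Qed.

Hypothesis F'_le : coefs_le w (w p%:R) F^`().

(** The derivative of the translate has coefficients [k] times those of the translate, all bounded
    by [w p%:R]; and [k] has value 1 when p does not divide it. *)
Lemma coef_translate_le x k : w x <= 1 -> ~~ (p %| k)%N ->
  w (F \Po ('X + x%:P))`_k <= w p%:R.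
Proof.
case: k => [|k] x1 pk; first by rewrite dvdn0 in pk.
have := coefs_le_comp_XaddC (absval_ge0 w _) x1 F'_le k.
suff -> : F^`() \Po ('X + x%:P) = (F \Po ('X + x%:P))^`().
  rewrite coef_deriv -[_ *+ k.+1]mulr_natr absvalM.
  by rewrite (absval_nat_prime p_pr wp1 pk) mulr1.
by rewrite deriv_comp derivD derivX derivC addr0 mulr1.
Qed.

Lemma preimage_integral t : w F.[t] <= 1 -> w t <= 1.
Proof.
move=> Ft1; rewrite leNgt; apply/negP => t1; move: Ft1.
by rewrite (horner_monic_large F_mon szF F_int t1) leNgt exprn_egt1 // -lt0n d_gt0.
Qed.

(* [zs] lists [t - x] for the roots [t] of [F = y], with multiplicity. *)
Lemma pullback x y : w x <= 1 -> w y <= 1 -> exists zs : seq L,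
  [/\ size zs = d,
      forall z, (z \in zs) = (F.[x + z] == y),
      {in zs, forall z, w z <= 1},
      w (F.[x] - y) = \prod_(z <- zs) w z &
      forall r, 0 < r -> w p%:R < \prod_(z <- zs | r <= w z) w z ->
        (p %| count (fun z => (w z < r)%R) zs)%N].
Proof.
move=> x1 y1.
have szFy : size (F - y%:P) = d.+1.
  by rewrite size_polyDl szF // size_polyN ltnS (leq_trans (size_polyC_leq1 _)).
have Fy_mon : F - y%:P \is monic.
  rewrite monicE lead_coefDl ?(monicP F_mon) // szF size_polyN ltnS.
  by rewrite (leq_trans (size_polyC_leq1 _)).
have [rs def_F] := monic_split Fy_mon.
have mem_rs t : (t \in rs) = (F.[t] == y).
  by rewrite -root_prod_XsubC_seq -def_F !hornerE subr_eq0.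
pose zs := [seq t - x | t <- rs].
have mem_zs z : (z \in zs) = (F.[x + z] == y).
  rewrite -mem_rs; apply/mapP/idP => [[t trs ->]|xz]; first by rewrite addrC subrK.
  by exists (x + z); rewrite // addrC addKr.
have zs1 : {in zs, forall z, w z <= 1}.
  move=> z; rewrite mem_zs => /eqP Fz.
  have -> : z = (x + z) - x by rewrite addrAC subrr add0r.
  by rewrite absvalD_le ?absvalN // preimage_integral ?Fz.
have def_G : (F \Po ('X + x%:P)) - y%:P = \prod_(z <- zs) ('X - z%:P).
  rewrite big_map -[y%:P](comp_polyC _ ('X + x%:P)) -rmorphB /= def_F.
  rewrite rmorph_prod /=; apply: eq_bigr => t _.
  by rewrite comp_polyB comp_polyX comp_polyC polyCB opprB addrA addrAC.
exists zs; split=> //.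
- have := congr1 (fun q : {poly L} => size q) def_F.
  by rewrite szFy size_prod_XsubC size_map => -[].
- have := congr1 (fun q => w q.[0]) def_G.
  rewrite !hornerE horner_comp !hornerE => ->.
  rewrite horner_prod absval_prod; apply: eq_bigr => z _.
  by rewrite !hornerE ?add0r absvalN.
(* If p did not divide the vertex abscissa [A], the coefficient there would be both equal to the far
   product and at most [w p%:R]. As [A] is nonzero, subtracting [y] does not affect that
   coefficient. *)
move=> r r0 lt_P; apply: contraT => pA.
have [_ _] := prod_XsubC_coef w zs r0.
set A := count _ zs in pA * => coefA.
move: lt_P; rewrite -coefA -def_G coefB coefC.
have A0 : A != 0%N by apply: contraNneq pA => ->; rewrite dvdn0.
by rewrite (negbTE A0) subr0 ltNge coef_translate_le.
Qed.

Lemma prod_le_subprod (P : pred L) (zs : seq L) : {in zs, forall z, w z <= 1} ->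
  \prod_(z <- zs) w z <= \prod_(z <- zs | P z) w z.
Proof.
move=> zs1; rewrite (bigID P) /= ler_piMr ?prodr_ge0 // => [z _|].
  exact: absval_ge0.
rewrite big_seq_cond; apply: prodr_ile1 => z /andP[zs_z _].
by rewrite absval_ge0 zs1.
Qed.

Lemma ex_preimage x : w x <= 1 -> exists2 x', F.[x'] = x & w x' <= 1.
Proof.
move=> x1; have [] := pullback (_ : w 0 <= 1) x1; first by rewrite absval0.
case=> [|z zs] [sz mem_zs _ _ _]; first by move: d_gt0; rewrite -sz.
have /eqP Fz : F.[0 + z] == x by rewrite -mem_zs mem_head.
by rewrite add0r in Fz; exists z; rewrite // preimage_integral ?Fz.
Qed.

(** The product of the values [w z] is below 1, so some root lies in the open unit disk; their
    number is a multiple of p, so there are at least two. The larger of two such values has a square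
    at least the whole product. *)
Lemma ex_close_preimage x' y : w x' <= 1 -> w y <= 1 -> w (F.[x'] - y) < 1 ->
  exists z, [/\ F.[x' + z] = y, w z < 1 & w (F.[x'] - y) <= w z ^+ 2].
Proof.
move=> x1 y1; have [zs [_ mem_zs zs1 -> dvd_count]] := pullback x1 y1.
(* Roots outside the open unit disk have value exactly 1, so the condition for divisibility at
   radius 1 reads [w p%:R < 1]. *)
have far1 : \prod_(z <- zs | 1 <= w z) w z = 1.
  rewrite big_seq_cond big1 // => z /andP[/zs1 z1 z2].
  by apply/le_anti/andP.
have := dvd_count 1 ltr01; rewrite far1 => /(_ wp1) p_dvd.
rewrite (bigID (fun z => 1 <= w z)) /= far1 mul1r.
under eq_bigl => z do rewrite -ltNge.
rewrite -big_filter; move: p_dvd; rewrite -size_filter.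
set s := seq.filter _ _ => p_dvd.
have s_lt z : z \in s -> F.[x' + z] = y /\ w z < 1.
  by rewrite mem_filter mem_zs => /andP[? /eqP].
have : {subset s <= zs} by move=> z; rewrite mem_filter => /andP[].
case: s p_dvd s_lt => [|z1 [|z2 s]] /= p_dvd s_lt s_zs.
- by rewrite big_nil ltxx.
- by move: p_dvd; rewrite dvdn1; case: eqP p_pr => // ->.
rewrite !big_cons mulrA => _.
have [Fz1 lt1] : F.[x' + z1] = y /\ w z1 < 1 by apply: s_lt; rewrite mem_head.
have [Fz2 lt2] : F.[x' + z2] = y /\ w z2 < 1.
  by apply: s_lt; rewrite !inE eqxx orbT.
have rest1 : w z1 * w z2 * \prod_(z <- s) w z <= w z1 * w z2.
  rewrite ler_piMr ?mulr_ge0 ?absval_ge0 // big_seq.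
  apply: prodr_ile1 => z zs_z; rewrite absval_ge0 zs1 //.
  by apply: s_zs; rewrite !inE zs_z !orbT.
have [le12|/ltW le21] := leP (w z1) (w z2); [exists z2 | exists z1]; split=> //.
  by apply: le_trans rest1 _; rewrite expr2 ler_wpM2r ?absval_ge0.
by apply: le_trans rest1 _; rewrite expr2 ler_wpM2l ?absval_ge0.
Qed.

Variable a : L.
Hypothesis a_int : w a <= 1.
Local Notation lev := (level F a).

Lemma level_integral n x : lev n x -> w x <= 1.
Proof.
elim: n x => [|n IHn] x; first by rewrite /level /= => ->.
by rewrite /level iterSr => /IHn; apply: preimage_integral.
Qed.

Lemma levelS n x : lev n F.[x] -> lev n.+1 x.
Proof. by rewrite /level iterSr. Qed.

(** Induction on [k] with [w p%:R ^+ (2 ^ k) < w (x - y)]: each pullback at least takes the square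
    root of the distance and so lowers [k] by one, until [k = 0] gives the bound. *)
Lemma ex_ball_pair n x y : 0 < w p%:R -> lev n x -> lev n y -> x != y ->
  w (x - y) < 1 ->
  exists m x' y', [/\ lev m x', lev m y', w p%:R < w (x' - y') & w (x' - y') < 1].
Proof.
move=> wp0; have [k] : exists k, w p%:R ^+ (2 ^ k) < w (x - y) \/ x = y.
  have [->|xy] := eqVneq x y; first by exists 0; right.
  have p1 : 1 < (w p%:R)^-1 by rewrite invf_gt1.
  have [k lt_k] := exprn_unbounded (w (x - y))^-1 p1.
  exists k; left; have xy0 : 0 < w (x - y) by rewrite absval_gt0 subr_eq0.
  have {lt_k} : w p%:R ^+ k < w (x - y).
    by rewrite -ltf_pV2 ?posrE ?exprn_gt0 // -exprVn lt_k.
  apply: le_lt_trans.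
    by rewrite ler_wiXn2l ?(ltW wp1) ?(ltW wp0) // ltnW // ltn_expl.
move=> + lx ly xy; case=> [lt_k|/eqP]; last by rewrite (negbTE xy).
elim: k n x y {xy} lx ly lt_k => [|k IHk] n x y lx ly lt_k xy1.
  by exists n, x, y.
have [x' Fx' x'1] := ex_preimage (level_integral lx).
have [] := ex_close_preimage x'1 (level_integral ly); rewrite Fx' //.
move=> z [Fz z1 le_z]; apply: (IHk n.+1 (x' + z) x').
- by apply: levelS; rewrite Fz.
- by apply: levelS; rewrite Fx'.
- rewrite [x' + z]addrC addrK.
  rewrite -(@ltr_pXn2r _ 2) ?nnegrE ?exprn_ge0 ?absval_ge0 //.
  by rewrite -exprM -expnSr (lt_le_trans lt_k).
- by rewrite [x' + z]addrC addrK.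
Qed.

(** One pullback writes the distance as a product of distances at the next level, each repeated a
    multiple of p times. By induction each is a [p ^ k]-th power, so the product is a [p ^ k.+1]-th
    power. *)
Lemma ball_pair_pow (E : nat -> set L) k n x y :
  (forall m, divring_closed (mem (E m))) -> (forall m t, lev m t -> E m t) ->
  lev n x -> lev n y -> w p%:R < w (x - y) ->
  exists2 g, value_group w (E (n + k)%N) g & g ^+ (p ^ k) = w (x - y).
Proof.
move=> E_closed levelE; elim: k n x y => [|k IHk] n x y lx ly lt_xy.
  exists (w (x - y)); rewrite ?expn0 ?expr1 // addn0; exists (x - y) => //; split.
    have [_ sub _] := E_closed n.
    by apply/set_mem/sub; apply/mem_set; apply: levelE.
  by rewrite /= -(absval_gt0 w) (le_lt_trans _ lt_xy) ?absval_ge0.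
have [x' Fx' x'1] := ex_preimage (level_integral lx).
have [zs [_ mem_zs zs1 + dvd_count]] := pullback x'1 (level_integral ly).
rewrite Fx' => def_xy; rewrite def_xy -(big_map w predT id) expnSr.
(* All factors are at most 1, so each is at least their product; the new distances thus stay above
   [w p%:R] and the induction applies to them. *)
have lt_z z : z \in zs -> w p%:R < w z.
  move=> zs_z; apply: lt_le_trans lt_xy _; rewrite def_xy.
  rewrite (big_rem z) //= ler_piMr ?absval_ge0 // big_seq.
  by apply: prodr_ile1 => t /mem_rem/zs1 ->; rewrite absval_ge0.
apply: prod_pow_dvdn_count; first exact: value_group_closed.
  move=> _ /mapP[z zs_z ->]; apply: dvdn_count_mem.
    move=> r r0; rewrite count_map; apply: dvd_count => //.
    apply: lt_le_trans lt_xy _; rewrite def_xy.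
    exact: prod_le_subprod.
  by rewrite (le_lt_trans _ (lt_z z zs_z)) ?absval_ge0.
move=> _ /mapP[z zs_z ->]; rewrite addnS -addSn.
have [|||g Gg gz] := IHk n.+1 (x' + z) x';
  last by exists g; rewrite // gz [x' + z]addrC addrK.
- by apply: levelS; have /eqP -> : F.[x' + z] == y by rewrite -mem_zs.
- by apply: levelS; rewrite Fx'.
- by rewrite [x' + z]addrC addrK lt_z.
Qed.

End Pullback.

(** * Iterates, their preimages and integrality of the critical points *)

Lemma horner_iter_poly (K : fieldType) (f : {poly K}) n x :
  (iter_poly f n).[x] = iter n (horner f) x.
Proof.
elim: n => [|n IHn]; first by rewrite hornerX.
by rewrite /iter_poly iterS horner_comp -/(iter_poly f n) IHn.
Qed.

Lemma map_iter_poly (K L : fieldType) (i : {rmorphism K -> L}) (f : {poly K}) n :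
  map_poly i (iter_poly f n) = iter_poly (map_poly i f) n.
Proof.
elim: n => [|n IHn]; first exact: map_polyX.
by rewrite /iter_poly !iterS map_comp_poly -!/(iter_poly _ n) IHn.
Qed.

Lemma iter_preimageE (K L : fieldType) (i : {rmorphism K -> L})
    (f : {poly K}) n a x :
  iter_preimage i f n a x <-> level (map_poly i f) (i a) n x.
Proof.
rewrite /iter_preimage /level /= rootE rmorphB /= map_polyC map_iter_poly.
by rewrite hornerD hornerN hornerC horner_iter_poly subr_eq0; split=> /eqP.
Qed.

Lemma iter_preimage_finite (K L : fieldType) (i : {rmorphism K -> L})
    (f : {poly K}) n a m :
  (iter_preimage i f n a #= `I_m)%card ->
  exists s : seq L, iter_preimage i f n a `<=` [set` s].
Proof.
move=> card_m; have fin : finite_set (iter_preimage i f n a).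
  by apply/finite_setP; exists m.
by exists (enum_fset (fset_set (iter_preimage i f n a))); rewrite fset_setK.
Qed.

(* The orbit of a point outside the unit disk escapes to infinity. *)
Lemma critical_integral (R : realType) (L C : fieldType) (w : absval R L)
    (u : absval R C) (j : {rmorphism L -> C}) (F : {poly L}) d c :
  absval_extends w u j -> F \is monic -> size F = d.+1 -> (1 < d)%N ->
  coefs_le w 1 F -> absval_bounded u (postcritical_set (map_poly j F)) ->
  root F^`() c -> w c <= 1.
Proof.
move=> uw F_mon szF d1 F1 [M M_ub] crit; rewrite leNgt; apply/negP => c1.
have [n lt_n] := exprn_unbounded M c1.
have iter_val : w (iter n (horner F) c) = w c ^+ (d ^ n).
  elim: n {lt_n} => [|n IHn]; first by rewrite expr1.
  rewrite iterS (horner_monic_large F_mon szF F1) IHn ?exprn_egt1 //.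
    by rewrite -exprM -expnSr.
  by rewrite -lt0n expn_gt0 (ltnW d1).
have : w c ^+ (d ^ n) <= M.
  rewrite -iter_val -uw -horner_iter_poly -horner_map /= map_iter_poly.
  apply: M_ub; exists n, (j c); split=> //.
  by rewrite /critical_point deriv_map fmorph_root.
apply/negP; rewrite -ltNge (lt_le_trans lt_n) // ler_eXn2l //.
by rewrite ltnW // ltn_expl.
Qed.

(** * Divisibility of the ramification indices by growing powers of p *)

Theorem theorem2 (R : realType) (p d : nat)
  (K : fieldType) (v : absval R K)
  (Kchar0 : [pchar K] =i pred0) (Klocal : local_field v p)
  (L : closedFieldType) (i : {rmorphism K -> L}) (w : absval R L)
  (Lclosure : is_algebraic_closure i) (wv : absval_extends v w i)
  (C : fieldType) (j : {rmorphism L -> C}) (u : absval R C)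
  (Ccompletion : is_completion w u j)
  (f : {poly K})
  (f_int : f \is a polyOver (val_ring v))
  (f_monic : f \is monic) (f_deg : size f = d.+1) (f0 : f.[0] = 0)
  (p_dvd_d : (p %| d)%N)
  (f_pcb : absval_bounded u (postcritical_set (map_poly j (map_poly i f))))
  (a : K) (a_int : a \in val_ring v)
  (a_avoids : avoids u (j (i a)) (postcritical_set (map_poly j (map_poly i f))))
  (a_sep : forall n : nat, (iter_preimage i f n a #= `I_(d ^ n))%card) :
  logn p (ramification_index v w (arboreal_field i f a n)) @[n --> \oo] --> \oo.
Proof.
have [[pi [/andP[pi0 pi1] v_pi]] _ _ [p_pr vp1]] := Klocal.
have natK0 n : (n%:R == 0 :> K) = (n == 0%N) by move/pcharf0P: Kchar0.
have wp_v : w p%:R = v p%:R by rewrite -wv rmorph_nat.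
have wp1 : w p%:R < 1 by rewrite wp_v.
have wp0 : 0 < w p%:R by rewrite wp_v absval_gt0 natK0 -lt0n prime_gt0.
(* For [d = 0] the polynomial would be a nonzero constant, against [f(0) = 0]. *)
have d0 : (0 < d)%N.
  rewrite lt0n; apply/eqP => d0.
  have /eqP/size_poly1P[c c0 def_f] : size f = 1%N by rewrite f_deg d0.
  by move: f0 c0; rewrite def_f hornerC => ->; rewrite eqxx.
have d1 : (1 < d)%N := leq_trans (prime_gt1 p_pr) (dvdn_leq d0 p_dvd_d).
set F := map_poly i f in f_pcb a_avoids *.
have F_mon : F \is monic by rewrite map_monic.
have szF : size F = d.+1 by rewrite size_map_poly.
have F_int : coefs_le w 1 F.
  move=> k; rewrite coef_map /= wv; have [kf|fk] := ltnP k (size f).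
    by have /allP/(_ _ (mem_nth 0 kf)) := f_int; rewrite inE.
  by rewrite nth_default // absval0 ler01.
have dL0 : d%:R != 0 :> L by rewrite -(rmorph_nat i) fmorph_eq0 natK0 -lt0n.
have F'_le : coefs_le w (w p%:R) F^`().
  apply: (coefs_le_deriv p_dvd_d F_mon szF d0 dL0) => c.
  exact: (critical_integral (completion_extends Ccompletion) F_mon szF d1).
have ia_int : w (i a) <= 1 by rewrite wv; move: a_int; rewrite inE.
pose lev := level F (i a).
have levE n x : iter_preimage i f n a x <-> lev n x by apply: iter_preimageE.
have [m [x [y [lx ly lt_xy xy1]]]] : exists m x y,
    [/\ lev m x, lev m y, w p%:R < w (x - y) & w (x - y) < 1].
  have [x Fx x1] := ex_preimage p_pr wp1 F_mon szF d0 F_int F'_le ia_int.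
  have [zs [szs mem_zs zs1 _ dvd_count]] :=
    pullback p_pr wp1 F_mon szF d0 F_int F'_le x1 ia_int.
  have zs0 : 0 \in zs by rewrite mem_zs addr0 Fx.
  (* The list has length [d], and by separability at level 1 its entries form a set of [d]
     elements. *)
  have uzs : uniq zs.
    have := a_sep 1%N; rewrite expn1.
    have -> : iter_preimage i f 1 a = [set` [fset (x + z)%R | z in zs]%fset].
      apply/seteqP; split=> [t /levE Ft|t /= /imfsetP[z + ->]] /=.
        apply/imfsetP; exists (t - x); rewrite /= ?mem_zs addrC subrK //.
        exact/eqP.
      by rewrite /= mem_zs => /eqP Fz; apply/levE.
    move=> /card_eq_fsetP; rewrite card_imfset /=; last exact: addrI.
    by move=> szu; apply/negPn; rewrite -ltn_size_undup szu szs ltnn.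
  have [/hasP[z zs_z /andP[z0 z1]]|/hasPn far] :=
      boolP (has (fun z => (z != 0) && (w z < 1)) zs).
    apply: (@ex_ball_pair _ _ _ _ _ _ p_pr wp1 F_mon szF d0 F_int F'_le _ ia_int
              1 (x + z) x wp0) => //.
    - by move: zs_z; rewrite mem_zs => /eqP.
    - by rewrite -subr_eq0 [x + z]addrC addrK.
    - by rewrite [x + z]addrC addrK.
  (* If 0 were the only entry in the open unit disk, it would be counted once and p would divide
     1. *)
  have := dvd_count 1 ltr01; rewrite big_seq_cond big1 => [/(_ wp1)|z /andP[zs_z]].
    rewrite (@eq_in_count _ _ (pred1 0)) => [|z zs_z].
      by rewrite count_uniq_mem // zs0 dvdn1 => /eqP p1; move: p_pr; rewrite p1.
    move/far: zs_z; rewrite /= negb_and negbK.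
    by have [->|z0 /= /negbTE //] := eqVneq z 0; rewrite absval0 ltr01.
  by move=> z1; apply/le_anti; rewrite zs1.
pose E := arboreal_field i f a; pose e n := ramification_index v w (E n).
have clE n : divring_closed (mem (E n)) by apply: adjoin_closed.
have levE' n t : lev n t -> E n t by move=> /levE; apply: sub_adjoin.
(* For an infinite index [mul_index] would be 0 by convention, so finiteness is what makes [e n]
   positive and Lagrange's theorem available. *)
have finE n : finite_set
    [set [set g * h | h in value_group v setT] | g in value_group w (E n)].
  have [s sub_s] := iter_preimage_finite (a_sep n).
  have [t [N E_poly]] := adjoin_sub_poly Kchar0 Lclosure sub_s.
  exact: (finite_value_cosets wv E_poly).
have sE n : pos_subgroup (value_group w (E n)) by apply: value_group_closed.
have sK := value_group_base v.
have subE n : value_group v setT `<=` value_group w (E n).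
  move=> _ [c [_ c0] <-]; exists (i c); rewrite ?wv //.
  by split; [apply: range_sub_adjoin | rewrite /= fmorph_eq0].
have e_gt0 n : (0 < e n)%N by apply: mul_index_gt0 => //; case: (sE n).
have e_pow n g : value_group w (E n) g -> exists l : int, g ^+ e n = v pi ^ l.
  move=> /(mul_index_exp (sE n) sK (@subE n) (finE n))[c [_ c0] <-].
  exact: v_pi.
set W := w (x - y) in lt_xy xy1.
have W_pow k : exists2 g, value_group w (E (m + k)%N) g & g ^+ (p ^ k) = W.
  exact: (ball_pair_pow p_pr wp1 F_mon szF d0 F_int F'_le ia_int k clE levE').
have [l def_l] : exists l : int, W ^+ e m = v pi ^ l.
  by have [g] := W_pow 0; rewrite addn0 expn0 expr1 => Gg <-; apply: e_pow.
have W0 : 0 < W := lt_trans wp0 lt_xy.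
(* Since [W < 1], its power [W ^+ e m] is not 1, so the exponent [l] is nonzero; it is the fixed
   multiplier of [e]. *)
have l0 : (0 < `|l|)%N.
  rewrite absz_gt0; apply: contraTneq xy1 => l0; move: def_l.
  rewrite l0 expr0z => We1; apply: contraTN (eqxx (1 : R)) => W1.
  rewrite -[X in X == _]We1.
  by rewrite lt_eqF // exprn_ilt1 ?(ltW W0) // -lt0n.
(* Writing [W ^+ (e m * e (m + k))] as a power of [v pi] in two ways gives
   [l * e (m + k) = h * (p ^ k * e m)]. *)
have dvd_e k : (p ^ k %| `|l| * e (m + k))%N.
  have [g Gg def_W] := W_pow k; have [h def_h] := e_pow _ _ Gg.
  have powl : W ^+ (e m * e (m + k)%N) = v pi ^ (l * (e (m + k)%N)%:Z).
    by rewrite exprM def_l exprnP exprz_exp.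
  have powh : W ^+ (e m * e (m + k)%N) = v pi ^ (h * (p ^ k * e m)%N%:Z).
    by rewrite -exprz_exp -def_h -exprnP -def_W -!exprM mulnA mulnC.
  have /(congr1 absz) := ieexprIz pi0 (negbT (lt_eqF pi1)) (etrans (esym powl) powh).
  by rewrite !abszM !absz_nat => ->; rewrite mulnCA dvdn_mulr.
apply/cvgnyPge => A.
(* The divisibility bounds [n - m] by the p-adic valuations of [l] and [e n] together, so the
   valuation of [l] is added to the threshold. *)
exists (m + (A + logn p `|l|))%N => // n /= le_n.
have -> : n = (m + (n - m))%N by rewrite subnKC // (leq_trans _ le_n) ?leq_addr.
have := dvd_e (n - m)%N; rewrite pfactor_dvdn ?muln_gt0 ?l0 ?e_gt0 //.
rewrite lognM ?e_gt0 // => le_k; rewrite -(leq_add2l (logn p `|l|)).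
apply: leq_trans le_k.
by rewrite leq_subRL ?(leq_trans _ le_n) ?leq_addr // [(_ + A)%N]addnC.
Qed.
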